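(* There exist a compact metric space $X$ and a sequence $f_{0,\infty}=\{f_n\}_{n=0}^\infty$ of continuous self-maps of $X$ such that (1) $(X,f_{0,\infty})$ is weakly mixing of order $2$; and (2) $(\mathcal{M}(X),\hat f_{0,\infty})$ is not weakly mixing of order $2$.
   Context: Let $(X,d)$ be a compact metric space. A non-autonomous dynamical system $(X,f_{0,\infty})$ is given by a sequence $f_{0,\infty}=\{f_n\}_{n=0}^\infty$ of continuous self-maps of $X$; write $f_0^n=f_{n-1}\circ\cdots\circ f_0$ for $n\ge1$. $\mathcal{M}(X)$ is the space of all Borel probability measures on $X$ with the Prohorov metric $\mathcal{P}_d(\mu,\nu)=\inf\{\epsilon>0:\mu(A)\le\nu(A^\epsilon)+\epsilon \text{ and } \nu(A)\le\mu(A^\epsilon)+\epsilon \text{ for all Borel } A\subset X\}$, where $A^\epsilon=\{x\in X: d(x,A)<\epsilon\}$; its topology is the weak$^*$-topology and $\mathcal{M}(X)$ is a compact metric space. The induced system $(\mathcal{M}(X),\hat f_{0,\infty})$, $\hat f_{0,\infty}=\{\hat f_n\}_{n=0}^\infty$, consists of the continuous maps $\hat f_n(\mu)(A)=\mu(f_n^{-1}(A))$. For nonempty open $U,V\subset X$ let $N(U,V)=\{n\ge1: f_0^n(U)\cap V\neq\emptyset\}$. $(X,f_{0,\infty})$ is weakly mixing of order $n$ if $\bigcap_{i=1}^n N(U_i,V_i)\ne\emptyset$ for any nonempty open subsets $U_1,\dots,U_n,V_1,\dots,V_n$ of $X$. *)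

(* Defs.v *)
From HB Require Import structures.
From mathcomp Require Import all_boot all_order all_algebra.
From mathcomp Require Import all_classical all_reals all_analysis.
From mathcomp Require Import lra.

Set Implicit Arguments.
Unset Strict Implicit.
Unset Printing Implicit Defensive.

Import Order.TTheory GRing.Theory Num.Theory.
Import numFieldNormedType.Exports.

Local Open Scope classical_set_scope.
Local Open Scope ring_scope.

(* Measurable types are pointed in MathComp-Analysis, so a metric space has to
   be pointed (i.e. nonempty) to carry its Borel sigma-algebra. *)
#[short(type="pmetricType")]
HB.structure Definition PointedMetric (R : numDomainType) :=
  {T of Pointed T & Metric R T}.

Notation borel X := (g_sigma_algebraType (@open X)).

Section nonautonomous.
Variable T : topologicalType.
Implicit Types (f : nat -> T -> T) (U V : set T).

(* [orbit_map f n] is $f_{n-1} \circ \dots \circ f_0$. *)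
Fixpoint orbit_map f n : T -> T :=
  if n is m.+1 then f m \o orbit_map f m else id.

Definition hitting_times f U V : set nat :=
  [set n | (1 <= n)%N /\ (orbit_map f n @` U) `&` V !=set0].

Definition weakly_mixing f (n : nat) : Prop :=
  forall U V : 'I_n -> set T,
    (forall i, open (U i) /\ U i !=set0) ->
    (forall i, open (V i) /\ V i !=set0) ->
    \bigcap_(i in [set: 'I_n]) hitting_times f (U i) (V i) !=set0.

End nonautonomous.

(* A [probability] of the library is a function on all subsets, constrained on
   measurable sets only; requiring the value 0 elsewhere makes equality in
   [borel_prob X] coincide with equality of Borel measures. *)
Record borel_prob (R : realType) (X : pmetricType R) := BorelProb {
  borel_prob_val :> probability (borel X) R ;
  borel_prob_nonmeasurable : forall A : set (borel X),
    ~ measurable A -> borel_prob_val A = 0%E }.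

HB.instance Definition _ (R : realType) (X : pmetricType R) :=
  gen_eqMixin (borel_prob X).
HB.instance Definition _ (R : realType) (X : pmetricType R) :=
  gen_choiceMixin (borel_prob X).

Section borel_prob_of.
Local Open Scope ereal_scope.
Context (R : realType) (X : pmetricType R) (P : probability (borel X) R).

Definition truncate_measure (A : set (borel X)) : \bar R :=
  if `[< measurable A >] then P A else 0.

Lemma truncate_measureE A : measurable A -> truncate_measure A = P A.
Proof. by move=> mA; rewrite /truncate_measure asboolT. Qed.

Let truncate0 : truncate_measure set0 = 0.
Proof. by rewrite truncate_measureE// measure0. Qed.

Let truncate_ge0 A : 0 <= truncate_measure A.
Proof. by rewrite /truncate_measure; case: ifP. Qed.

Let truncate_sigma_additive : semi_sigma_additive truncate_measure.
Proof.
move=> F mF tF mUF; rewrite truncate_measureE//.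
under eq_fun do under eq_bigr do rewrite truncate_measureE//.
exact: measure_semi_sigma_additive.
Qed.

HB.instance Definition _ := isMeasure.Build _ _ _ truncate_measure
  truncate0 truncate_ge0 truncate_sigma_additive.

Let truncate_setT : truncate_measure setT = 1.
Proof. by rewrite truncate_measureE// probability_setT. Qed.

HB.instance Definition _ := Measure_isProbability.Build _ _ _
  truncate_measure truncate_setT.

Let truncate_nonmeasurable A : ~ measurable A -> truncate_measure A = 0.
Proof. by move=> mA; rewrite /truncate_measure asboolF. Qed.

Definition borel_prob_of : borel_prob X :=
  @BorelProb R X truncate_measure truncate_nonmeasurable.

Lemma borel_prob_ofE A : measurable A -> borel_prob_of A = P A.
Proof. exact: truncate_measureE. Qed.

End borel_prob_of.

Lemma borel_probP (R : realType) (X : pmetricType R) (mu nu : borel_prob X) :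
  (forall A : set (borel X), measurable A -> mu A = nu A) -> mu = nu.
Proof.
case: mu nu => [mu mu0] [nu nu0] /= munu.
have {}munu : mu = nu :> (set (borel X) -> \bar R).
  apply/funext => A; have [/munu//|nmA] := pselect (measurable A).
  by rewrite mu0// nu0.
suff e : mu = nu.
  by case: _ / e nu0 => nu0; congr BorelProb; exact: Prop_irrelevance.
case: mu nu munu {mu0 nu0} => [m c] [n c'] /= mn.
move: mn c c' => -> c c'; congr Probability.Pack.
case: c c' => [[a1 a2] [a3] [a4] [a5] [a6] [a7] [a8]].
case=> [[b1 b2] [b3] [b4] [b5] [b6] [b7] [b8]].
rewrite (Prop_irrelevance a1 b1) (Prop_irrelevance a2 b2).
rewrite (Prop_irrelevance a3 b3) (Prop_irrelevance a4 b4).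
rewrite (Prop_irrelevance a5 b5) (Prop_irrelevance a6 b6).
by rewrite (Prop_irrelevance a7 b7) (Prop_irrelevance a8 b8).
Qed.

Section thickening.
Context (R : realType) (X : metricType R).
Implicit Types (x : X) (A : set X) (e : R).

(* The infimum is taken in [\bar R]: the distance to [set0] is [+oo]. *)
Definition dist_set x A : \bar R :=
  ereal_inf [set (mdist x a)%:E | a in A].

Definition thickening A e : set X := [set x | (dist_set x A < e%:E)%E].

Lemma thickeningP A e x :
  thickening A e x <-> exists2 a, A a & mdist x a < e.
Proof.
split=> [/ereal_inf_lt[_ [a Aa <-]]|[a Aa xa]].
  by rewrite lte_fin => xa; exists a.
rewrite /thickening /=; apply: le_lt_trans (_ : (mdist x a)%:E < _)%E.
  by apply: ereal_inf_lbound; exists a.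
by rewrite lte_fin.
Qed.

Lemma sub_thickening A e : 0 < e -> A `<=` thickening A e.
Proof. by move=> e0 x Ax; apply/thickeningP; exists x; rewrite ?mdistxx. Qed.

Lemma thickeningS A e e' : e <= e' -> thickening A e `<=` thickening A e'.
Proof.
move=> ee' x /thickeningP[a Aa xa]; apply/thickeningP; exists a => //.
exact: lt_le_trans ee'.
Qed.

Lemma thickening_thickening A e e' :
  thickening (thickening A e) e' `<=` thickening A (e + e').
Proof.
move=> x /thickeningP[y /thickeningP[a Aa ya] xy]; apply/thickeningP.
exists a => //; apply: le_lt_trans (metric_triangle x y a) _.
by rewrite addrC ltrD.
Qed.

Lemma open_thickening A e : open (thickening A e).
Proof.
have -> : thickening A e = \bigcup_(a in A) ball a e.
  apply/seteqP; split=> [x /thickeningP[a Aa xa]|x [a Aa]].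
    by exists a => //; rewrite ballEmdist /= metric_sym.
  by rewrite ballEmdist /= => xa; apply/thickeningP; exists a => //;
    rewrite metric_sym.
apply: bigcup_open => a _; rewrite openE => x; rewrite ballEmdist /= => ax.
apply/nbhs_ballP; exists (e - mdist a x); first by rewrite /= subr_gt0.
move=> y; rewrite !ballEmdist /= => xy.
by apply: le_lt_trans (metric_triangle a x y) _; rewrite addrC -ltrBrDr.
Qed.

Lemma bigcap_thickening A :
  closed A -> \bigcap_n thickening A n.+1%:R^-1 = A.
Proof.
move=> cA; apply/seteqP; split=> [x Ax|x Ax n _]; last first.
  by apply: sub_thickening Ax; rewrite invr_gt0.
apply: cA => B /nbhs_ballP[e /= e0 eB].
have [n ne] : exists n, n.+1%:R^-1 < e.
  have [n _ ne] := near_infty_natSinv_lt (PosNum e0).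
  by exists n; exact: (ne n (leqnn n)).
have /thickeningP[a Aa xa] := Ax n I.
by exists a; split=> //; apply: eB; rewrite ballEmdist /=; apply: lt_trans ne.
Qed.

End thickening.

Section borel.
Context (R : realType) (X : pmetricType R).

Lemma open_measurable_borel (U : set X) : open U -> measurable (U : set (borel X)).
Proof. exact: sub_sigma_algebra. Qed.

Lemma measurable_thickening (A : set X) (e : R) :
  measurable (thickening A e : set (borel X)).
Proof. by apply: open_measurable_borel; exact: open_thickening. Qed.

Lemma closed_measurable_borel (F : set X) :
  closed F -> measurable (F : set (borel X)).
Proof.
move=> cF; rewrite -[F]setCK; apply: measurableC; apply: open_measurable_borel.
exact: closed_openC.
Qed.

End borel.

Section prohorov.
Context (R : realType) (X : pmetricType R).
Implicit Types (mu nu la : borel_prob X) (e : R).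

Definition prohorov_set mu nu : set R :=
  [set e | 0 < e /\ forall A : set (borel X), measurable A ->
     (mu A <= nu (thickening A e) + e%:E)%E /\
     (nu A <= mu (thickening A e) + e%:E)%E].

Definition prohorov mu nu : R := inf (prohorov_set mu nu).

Let prohorov_set1 mu nu : prohorov_set mu nu 1.
Proof.
split=> // A mA; split; rewrite (le_trans (probability_le1 _ mA))// leeDr//;
  exact: measure_ge0.
Qed.

Let lbound_prohorov_set mu nu : lbound (prohorov_set mu nu) 0.
Proof. by move=> e [/ltW]. Qed.

Lemma prohorov_ge0 mu nu : 0 <= prohorov mu nu.
Proof. by apply: lb_le_inf; [exists 1|exact: lbound_prohorov_set]. Qed.

Lemma prohorov_le mu nu e : prohorov_set mu nu e -> prohorov mu nu <= e.
Proof. by apply: ge_inf; exists 0; exact: lbound_prohorov_set. Qed.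

Lemma prohorov_lt mu nu e : prohorov mu nu < e -> prohorov_set mu nu e.
Proof.
move=> /inf_lt[|e' [e'0 He'] e'e]; first by exists 1.
split=> [|A mA]; first exact: lt_trans e'e.
have mT r := measurable_thickening A r.
have [H1 H2] := He' A mA; split.
  apply: le_trans H1 _; apply: leeD; last by rewrite lee_fin ltW.
  by rewrite le_measure ?inE//; exact/thickeningS/ltW.
apply: le_trans H2 _; apply: leeD; last by rewrite lee_fin ltW.
by rewrite le_measure ?inE//; exact/thickeningS/ltW.
Qed.

Let prohorovxx mu : prohorov mu mu = 0.
Proof.
apply/eqP; rewrite eq_le prohorov_ge0 andbT; apply/ler_addgt0Pl => e e0.
rewrite addr0; apply: prohorov_le; split=> // A mA.
have ? : (mu A <= mu (thickening A e) + e%:E)%E.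
  apply: le_trans (_ : mu (thickening A e) <= _)%E; last first.
    by rewrite leeDl// lee_fin ltW.
  rewrite le_measure ?inE//; first exact: measurable_thickening.
  exact: sub_thickening.
by [].
Qed.

Let prohorov_sym mu nu : prohorov mu nu = prohorov nu mu.
Proof.
rewrite /prohorov; congr inf; apply/seteqP.
by split=> e [e0 H]; split=> // A /H[].
Qed.

Let prohorov_triangle nu mu la :
  prohorov mu la <= prohorov mu nu + prohorov nu la.
Proof.
apply/ler_addgt0Pr => e e0; rewrite [e]splitr addrACA.
have : prohorov mu nu < prohorov mu nu + e / 2 by rewrite ltrDl divr_gt0.
have : prohorov nu la < prohorov nu la + e / 2 by rewrite ltrDl divr_gt0.
move: (_ + e / 2) => b /prohorov_lt[b0 Hb].
move: (_ + e / 2) => a /prohorov_lt[a0 Ha].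
have H (m1 m2 m3 : borel_prob X) (c d : R) (A : set X) :
    (m1 A <= m2 (thickening A c) + c%:E)%E ->
    (m2 (thickening A c) <= m3 (thickening (thickening A c) d) + d%:E)%E ->
    (m1 A <= m3 (thickening A (c + d)) + (c + d)%:E)%E.
  move=> H1 H2; apply: le_trans H1 _.
  rewrite EFinD [(c%:E + _)%E]addeC addeA; apply: leeD => //.
  apply: le_trans H2 _; apply: leeD => //.
  rewrite le_measure ?inE//; try exact: measurable_thickening.
  exact: thickening_thickening.
apply: prohorov_le; split=> [|A mA]; first by rewrite addr_gt0.
split; first by apply: H (Ha A mA).1 (Hb _ (measurable_thickening A a)).1.
by rewrite addrC; apply: H (Hb A mA).2 (Ha _ (measurable_thickening A b)).2.
Qed.

Let prohorov_closed mu nu (F : set X) :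
  prohorov mu nu = 0 -> closed F -> (mu F <= nu F)%E.
Proof.
move=> munu0 cF.
have mT n : measurable (thickening F n.+1%:R^-1 : set (borel X)).
  exact: measurable_thickening.
have cvgT : nu (thickening F n.+1%:R^-1) @[n --> \oo] --> nu F.
  rewrite -[in X in _ --> X](bigcap_thickening cF).
  apply: nonincreasing_cvg_mu => //.
  - by rewrite (le_lt_trans (probability_le1 _ _)) ?ltry.
  - by rewrite bigcap_thickening//; exact: closed_measurable_borel.
  - move=> n m nm; apply/subsetPset; apply: thickeningS.
    by rewrite lef_pV2 ?posrE// ler_nat.
have cvgD : (nu (thickening F n.+1%:R^-1) + (n.+1%:R^-1)%:E)%E @[n --> \oo]
    --> (nu F + 0)%E.
  apply: cvgeD => //; last exact: cvge_harmonic.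
  by rewrite fin_num_adde_defl.
rewrite -[leRHS]adde0 -(cvg_lim _ cvgD)//.
apply: lime_ge; first by apply/cvg_ex; eexists; exact: cvgD.
apply: nearW => n.
have /prohorov_lt[_ /(_ F)[]//] : prohorov mu nu < n.+1%:R^-1.
  by rewrite munu0 invr_gt0.
exact: closed_measurable_borel.
Qed.

Let prohorov_positivity mu nu : prohorov mu nu = 0 -> mu = nu.
Proof.
move=> munu0.
have munuF (F : set X) : closed F -> mu F = nu F.
  move=> cF; apply/eqP; rewrite eq_le !prohorov_closed//.
  by rewrite prohorov_sym.
apply: borel_probP.
apply: (@measure_unique _ _ (borel X) (@open X) (fun=> setT)) => //.
- by move=> A B; exact: openI.
- by move=> _; exact: openT.
- by rewrite bigcup_const.
- move=> U oU; have mU : measurable (U : set (borel X)).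
    exact: open_measurable_borel.
  have := munuF _ (open_closedC oU); rewrite !probability_setC//.
  rewrite -[mu U]fineK ?fin_num_measure// -[nu U]fineK ?fin_num_measure//.
  rewrite -!EFinB => -[H].
  rewrite -[LHS]fineK ?fin_num_measure// -[RHS]fineK ?fin_num_measure//.
  by congr EFin; lra.
- by move=> _; rewrite ltey_eq fin_num_measure.
Qed.

HB.instance Definition _ := isMetric.Build R (borel_prob X)
  prohorovxx prohorov_positivity prohorov_sym prohorov_triangle.

End prohorov.

Section induced_map.
Context (R : realType) (X : pmetricType R).

Definition borel_fun (f : continuousType X X) : borel X -> borel X := f.

Let measurable_borel_fun f : measurable_fun setT (borel_fun f).
Proof.
apply: (@measurability _ _ (borel X) (borel X) setT (borel_fun f) (@open X)) => //.
move=> _ [U oU <-]; rewrite setTI.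
apply: open_measurable_borel; apply: open_comp => // x _; exact: cts_fun.
Qed.

HB.instance Definition _ f :=
  isMeasurableFun.Build _ _ _ _ (borel_fun f) (measurable_borel_fun f).

Definition induced_map (f : continuousType X X) (mu : borel_prob X) :
    borel_prob X :=
  borel_prob_of (distribution mu (borel_fun f)).

Lemma induced_mapE f mu (A : set (borel X)) :
  measurable A -> induced_map f mu A = mu (f @^-1` A).
Proof. by move=> mA; rewrite /induced_map borel_prob_ofE. Qed.

Lemma continuous_induced_map f :
  compact [set: X] -> continuous (induced_map f).
Proof.
move=> /compact_near_coveringP cptX mu.
apply/(@metricType_numDomainType.cvgrPdist_lt R (borel_prob X) _ (nbhs mu)).
move=> e e0.
have e20 : 0 < e / 2 by rewrite divr_gt0.
have : \forall d \near 0^'+, [set: X] `<=`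
    [set x | forall y, mdist x y < d -> mdist (f x) (f y) < e / 2].
  apply: cptX => x _.
  have e40 : 0 < e / 2 / 2 by rewrite divr_gt0.
  have /metricType_numDomainType.cvgrPdist_lt/(_ _ e40) :
    f @ x --> f x by exact: cts_fun.
  move=> /nbhs_ballP[r /= r0 rf].
  have r20 : 0 < r / 2 by rewrite divr_gt0.
  near=> x' d => /= y x'y.
  have xx' : mdist x x' < r / 2.
    by near: x'; apply/nbhs_ballP; exists (r / 2) => //= z; rewrite ballEmdist.
  have dr : d < r / 2 by near: d; exact: nbhs_right_lt.
  have fxx' : mdist (f x) (f x') < e / 2 / 2.
    by apply: rf; rewrite ballEmdist /=; lra.
  have fxy : mdist (f x) (f y) < e / 2 / 2.
    apply: rf; rewrite ballEmdist /=.
    by have := metric_triangle x x' y; lra.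
  have := metric_triangle (f x') (f x) (f y).
  by rewrite [mdist (f x') (f x)]metric_sym; lra.
move=> unif; near (at_right (0 : R)) => d.
have d0 : 0 < d by [].
have de : d < e / 2 by near: d; exact: nbhs_right_lt.
have df : [set: X] `<=`
    [set x | forall y, mdist x y < d -> mdist (f x) (f y) < e / 2].
  by near: d.
apply/nbhs_ballP; exists d => //= nu; rewrite ballEmdist /=.
move=> /prohorov_lt[_ munu].
apply: le_lt_trans (_ : e / 2 < e); last by lra.
apply: prohorov_le; split=> // A mA.
have mfA : measurable (f @^-1` A : set (borel X)).
  by rewrite -[_ @^-1` _]setTI; exact: measurable_borel_fun.
have mfT : measurable (f @^-1` thickening A (e / 2) : set (borel X)).
  rewrite -[_ @^-1` _]setTI; apply: measurable_borel_fun => //.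
  exact: measurable_thickening.
have sub : thickening (f @^-1` A : set X) d `<=`
    f @^-1` thickening A (e / 2).
  move=> x /thickeningP[a Aa xa]; apply/thickeningP; exists (f a) => //.
  exact: df.
have [H1 H2] := munu _ mfA.
rewrite !induced_mapE//; last 2 first.
  exact: measurable_thickening.
  exact: measurable_thickening.
split; [apply: le_trans H1 _|apply: le_trans H2 _];
  apply: leeD; rewrite ?lee_fin ?(ltW de)//;
  by rewrite le_measure ?inE//; exact: measurable_thickening.
Unshelve. all: by end_near.
Qed.

End induced_map.

(* Main.v *)
(* The affine maps [y |-> a y + b] ([a != 0]) of the line extend to
   homeomorphisms of its two-point compactification, here [-1, 1] through
   [x = y / (1 + |y|)]. They act transitively on pairs of distinct points, so a
   sequence of maps whose compositions run through a countable dense family of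
   them is weakly mixing of order 2. But they preserve betweenness: if half of
   the mass near 1/4 and half of the mass near 3/4 are sent close to 0, then so
   is everything near 1/2. Hence no composition can send at once a measure
   close to [(delta_(1/4) + delta_(3/4)) / 2] near [delta_0] and a measure close
   to [delta_(1/2)] near [delta_1]. *)
Require Import Defs.
From HB Require Import structures.
From mathcomp Require Import all_boot all_order all_algebra.
From mathcomp Require Import all_classical all_reals all_analysis.
From mathcomp Require Import ring lra.

Set Implicit Arguments.
Unset Strict Implicit.
Unset Printing Implicit Defensive.

Import Order.TTheory GRing.Theory Num.Theory.
Import numFieldNormedType.Exports.

Local Open Scope classical_set_scope.

(** * Affine maps of the line in the bounded coordinate *)

Section compactified_affine.
Local Open Scope ring_scope.
Context {R : realType}.
Implicit Types a b x p q : R.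

(* In the coordinate [y = x / (1 - |x|)], [caff a b] is [y |-> a y + b]. The
   denominators are cleared so that the formula also makes sense at the two
   ends [x = 1] and [x = -1]. *)
Definition caff_num a b x : R := a * x + b * (1 - `|x|).

Definition caff a b x : R :=
  caff_num a b x / (1 - `|x| + `|caff_num a b x|).

(** Both summands are nonnegative; the first vanishes only for [|x| = 1], where the numerator is
    [a * x != 0]. *)
Lemma caff_den_gt0 a b x : a != 0 -> `|x| <= 1 ->
  0 < 1 - `|x| + `|caff_num a b x|.
Proof.
move=> a0; rewrite le_eqVlt => /orP[/eqP x1|x1]; last first.
  by rewrite ltr_pwDl// subr_gt0.
rewrite /caff_num x1 subrr mulr0 addr0 add0r normr_gt0 mulf_neq0//.
by rewrite -normr_gt0 x1.
Qed.

Lemma norm_caff a b x : a != 0 -> `|x| <= 1 ->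
  `|caff a b x| = `|caff_num a b x| / (1 - `|x| + `|caff_num a b x|).
Proof.
by move=> a0 x1; rewrite normrM normfV (gtr0_norm (caff_den_gt0 _ _ _)).
Qed.

Lemma caff_le1 a b x : a != 0 -> `|x| <= 1 -> `|caff a b x| <= 1.
Proof.
move=> a0 x1; rewrite norm_caff// ler_pdivrMr ?caff_den_gt0//.
by rewrite mul1r lerDr subr_ge0.
Qed.

(* On [0 <= x] the right-hand side is a pair of affine inequalities in [x],
   hence a convex condition. *)
Lemma caff_lt_half a b x : a != 0 -> `|x| <= 1 ->
  (`|caff a b x| < 2^-1) = (`|caff_num a b x| < 1 - `|x|).
Proof.
move=> a0 x1; rewrite norm_caff// ltr_pdivrMr ?caff_den_gt0//.
by apply/idP/idP; lra.
Qed.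

Lemma caff_between a b x1 x2 x3 : a != 0 ->
  0 <= x1 -> x1 <= x2 -> x2 <= x3 -> x3 <= 1 ->
  `|caff a b x1| < 2^-1 -> `|caff a b x3| < 2^-1 -> `|caff a b x2| < 2^-1.
Proof.
move=> a0 x10 x12 x23 x31; rewrite !caff_lt_half//;
  do ?by rewrite ger0_norm; lra.
rewrite /caff_num (ger0_norm x10) !(@ger0_norm _ x2, @ger0_norm _ x3); try lra.
rewrite !ltr_norml => /andP[A B] /andP[C D].
have [x13|x31'] := ltP x1 x3; last by have -> : x2 = x1 by [lra]; rewrite A B.
(* Each inequality at [x2], multiplied by [x3 - x1 > 0], is [x3 - x2] times the one at [x1] plus
   [x2 - x1] times the one at [x3]. *)
by apply/andP; split; nra.
Qed.

(** In the coordinate [y], the inverse of [a y + b] is [y / a - b / a]. By [D] and [N], the two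
    ingredients of the outer map are [1 - |x|] and [x] over one common positive denominator, which
    cancels. *)
Lemma caffK a b x : a != 0 -> `|x| <= 1 ->
  caff a^-1 (- b / a) (caff a b x) = x.
Proof.
move=> a0 x1; have d0 := caff_den_gt0 b a0 x1.
have D : 1 - `|caff a b x| = (1 - `|x|) / (1 - `|x| + `|caff_num a b x|).
  rewrite norm_caff//; field; exact: lt0r_neq0.
have N : caff_num a^-1 (- b / a) (caff a b x) =
    x / (1 - `|x| + `|caff_num a b x|).
  rewrite {1}/caff_num D {1}/caff {1}/caff_num; field.
  by rewrite a0 lt0r_neq0.
rewrite {1}/caff N D normrM normfV (gtr0_norm d0).
by field; rewrite lt0r_neq0//= lt0r_neq0//; lra.
Qed.

Lemma caff10 x : `|x| <= 1 -> caff 1 0 x = x.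
Proof.
by move=> x1; rewrite /caff /caff_num mul1r mul0r addr0 subrK divr1.
Qed.

(** In the coordinate [y] this is the line through two points with distinct abscissas; distinct
    ordinates make its slope nonzero. *)
Lemma caff_transitive2 p1 p2 q1 q2 : `|p1| < 1 -> `|p2| < 1 ->
  `|q1| < 1 -> `|q2| < 1 -> p1 != p2 -> q1 != q2 ->
  exists a b, [/\ a != 0, caff a b p1 = q1 & caff a b p2 = q2].
Proof.
move=> p11 p21 q11 q21 p12 q12.
pose y x : R := x / (1 - `|x|).
have yinj x x' : `|x| < 1 -> `|x'| < 1 -> y x = y x' -> x = x'.
  move=> x1 x'1 yy.
  (* Inverse of the chart [y]. *)
  have K u : `|u| < 1 -> u = y u / (1 + `|y u|).
    move=> u1; rewrite /y normrM normfV [`|1 - _|]gtr0_norm ?subr_gt0//.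
    by field; rewrite lt0r_neq0//=; lra.
  by rewrite (K x)// (K x')// yy.
have yp : y p1 - y p2 != 0.
  by rewrite subr_eq0; apply: contra_neq p12; exact: yinj.
have yq : y q1 - y q2 != 0.
  by rewrite subr_eq0; apply: contra_neq q12; exact: yinj.
pose a := (y q1 - y q2) / (y p1 - y p2); pose b := y q1 - a * y p1.
have E x q : `|x| < 1 -> `|q| < 1 -> a * y x + b = y q -> caff a b x = q.
  move=> x1 q1' e; have : caff_num a b x = y q * (1 - `|x|).
    by rewrite -e /caff_num /y; field; lra.
  rewrite /caff => ->; rewrite normrM [`|1 - _|]gtr0_norm ?subr_gt0//.
  rewrite /y normrM normfV [`|1 - `|q| |]gtr0_norm ?subr_gt0//.
  by field; rewrite ?lt0r_neq0//=; lra.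
exists a, b; split; first by rewrite mulf_neq0 ?invr_eq0.
  by apply: E => //; rewrite /b; ring.
by apply: E => //; rewrite /b /a; field.
Qed.

Lemma continuous_caff a b x : a != 0 -> `|x| <= 1 ->
  {for x, continuous (caff a b)}.
Proof.
move=> a0 x1.
have cd : {for x, continuous (fun z : R => 1 - `|z|)}.
  by apply: cvgB; [exact: cvg_cst|exact: norm_continuous].
have cn : {for x, continuous (caff_num a b)}.
  by apply: cvgD; apply: cvgM => //; exact: cvg_cst.
apply: cvgM => //; apply: cvgV; first by rewrite lt0r_neq0// caff_den_gt0.
by apply: cvgD => //; apply: cvg_norm.
Qed.

End compactified_affine.

(** * The compact metric space [-1, 1] and its affine maps *)

Definition seg (R : realType) := {x : R | (`|x| <= 1)%R}.

Section segment.
Local Open Scope ring_scope.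
Context {R : realType}.

HB.instance Definition _ := SubType.copy (seg R) {x : R | `|x| <= 1}.
HB.instance Definition _ := Choice.copy (seg R) {x : R | `|x| <= 1}.

Let seg_point_subproof : `|0 : R| <= 1.
Proof. by rewrite normr0. Qed.

HB.instance Definition _ := isPointed.Build (seg R)
  (exist (fun x : R => `|x| <= 1) 0 seg_point_subproof).

Let seg_dist (x y : seg R) : R := `|val x - val y|.

Let seg_distxx x : seg_dist x x = 0.
Proof. by rewrite /seg_dist subrr normr0. Qed.

Let seg_dist_positivity x y : seg_dist x y = 0 -> x = y.
Proof. by move=> /normr0_eq0/subr0_eq/val_inj. Qed.

Let seg_dist_sym x y : seg_dist x y = seg_dist y x.
Proof. exact: distrC. Qed.

Let seg_dist_triangle y x z : seg_dist x z <= seg_dist x y + seg_dist y z.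
Proof. exact: ler_distD. Qed.

HB.instance Definition _ := isMetric.Build R (seg R)
  seg_distxx seg_dist_positivity seg_dist_sym seg_dist_triangle.

Lemma seg_mdistE (x y : seg R) : mdist x y = `|val x - val y|.
Proof. by []. Qed.

Lemma clamp_subproof (x : R) : `|Num.max (-1) (Num.min 1 x)| <= 1.
Proof. by rewrite ler_norml le_max ge_max ge_min !lexx /=; lra. Qed.

(** The retraction of the line onto [-1, 1]. It turns real formulas into points of the segment, and
    presents [seg R] as a continuous image of a compact interval. *)
Definition clamp (x : R) : seg R :=
  exist (fun x : R => `|x| <= 1) _ (clamp_subproof x).

Lemma val_clamp (x : R) : `|x| <= 1 -> val (clamp x) = x.
Proof.
by rewrite ler_norml => /andP[x1 x2] /=; rewrite min_r// max_r.
Qed.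

Lemma clamp_val (x : seg R) : clamp (val x) = x.
Proof. by apply: val_inj; rewrite val_clamp//; exact: (valP x). Qed.

(** The retraction is 1-Lipschitz, so [e] itself serves as the radius. *)
Lemma continuous_clamp : continuous (clamp : R -> seg R).
Proof.
move=> x; apply/(@metricType_numDomainType.cvgrPdist_lt _ _ _ (nbhs x)).
move=> e e0; apply/nbhs_ballP; exists e => // y; rewrite /ball /=.
move=> xy; apply: le_lt_trans xy; rewrite seg_mdistE /= ler_norml.
have := ler_norm (x - y); have := ler_norm (y - x); rewrite (distrC y).
have : Num.max (-1) 1 = 1 :> R by rewrite max_r//; lra.
by case: (leP 1 x) => ?; case: (leP 1 y) => ?;
  case: (leP (-1) x) => ?; case: (leP (-1) y) => ?; lra.
Qed.

Lemma continuous_seg_val : continuous (val : seg R -> R).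
Proof.
move=> x; apply/(@cvgrPdist_lt _ _ _ (nbhs x)) => e e0.
by apply/nbhs_ballP; exists e.
Qed.

Lemma compact_seg : compact [set: seg R].
Proof.
have -> : [set: seg R] = clamp @` `[-1, 1].
  apply/seteqP; split=> // x _; exists (val x); last exact: clamp_val.
  by rewrite /= in_itv /= -ler_norml; exact: (valP x).
apply: continuous_compact; last exact: segment_compact.
exact/continuous_subspaceT/continuous_clamp.
Qed.

Definition seg_caff (a b : R) (x : seg R) : seg R := clamp (caff a b (val x)).

Lemma val_seg_caff a b x : a != 0 -> val (seg_caff a b x) = caff a b (val x).
Proof. by move=> a0; rewrite val_clamp// caff_le1//; exact: (valP x). Qed.

Lemma continuous_seg_caff a b : a != 0 -> continuous (seg_caff a b).
Proof.
move=> a0 x; apply: continuous_comp; last exact: continuous_clamp.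
apply: continuous_comp; first exact: continuous_seg_val.
by apply: continuous_caff => //; exact: (valP x).
Qed.

Lemma seg_caffK a b x : a != 0 -> seg_caff a^-1 (- b / a) (seg_caff a b x) = x.
Proof.
move=> a0; apply: val_inj; rewrite !val_seg_caff ?invr_eq0// caffK//.
exact: (valP x).
Qed.

Lemma seg_caff10 x : seg_caff 1 0 x = x.
Proof.
by apply: val_inj; rewrite val_seg_caff ?oner_eq0// caff10//; exact: (valP x).
Qed.

(** Density of the rationals; excluding [r] makes it possible to pick two distinct points even when
    two open sets coincide. *)
Lemma rat_in_open_seg (U : set (seg R)) (r : rat) : open U -> U !=set0 ->
  exists q : rat, [/\ q != r, `|ratr q : R| < 1 & U (clamp (ratr q))].
Proof.
move=> oU [u Uu]; have u1 : `|val u| <= 1 by exact: (valP u).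
have /nbhs_ballP[e /= e0 eU] : nbhs u U by exact: open_nbhs_nbhs.
have Q (q : rat) : Num.max (-1) (val u - e) < ratr q < Num.min 1 (val u + e) ->
    `|ratr q : R| < 1 /\ U (clamp (ratr q)).
  rewrite gt_max lt_min => /andP[/andP[? ?] /andP[? ?]].
  have q1 : `|ratr q : R| < 1 by rewrite ltr_norml; lra.
  split=> //; apply: eU; rewrite ballEmdist /= seg_mdistE val_clamp ?ltW//.
  by rewrite ltr_norml; lra.
have lohi : Num.max (-1) (val u - e) < Num.min 1 (val u + e).
  by move: u1; rewrite gt_max !lt_min ler_norml; lra.
have [q0] := rat_in_itvoo lohi; rewrite in_itv /= => q0I.
have /andP[lo0 hi0] := q0I.
have [q1] := rat_in_itvoo lo0; rewrite in_itv /= => q1I.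
(* If the first rational is the excluded one, a second is taken strictly below it in the same
   interval. *)
have [q0r|q0r] := eqVneq q0 r; last by exists q0; have [] := Q _ q0I.
exists q1; have [|? ?] := Q q1.
  by move/andP: q1I => [-> q10]; rewrite (lt_trans q10).
split=> //; rewrite -q0r; apply/eqP => q10.
by move: q1I; rewrite q10 ltxx andbF.
Qed.

End segment.

(** * Mass estimates and two-point measures *)

Section borel_prob_facts.
Local Open Scope ring_scope.
Context {R : realType} {X : pmetricType R}.
Implicit Types (mu nu : borel_prob X) (A B : set (borel X)).

Lemma probability_meet mu A B (r s : R) : measurable A -> measurable B ->
  (r%:E <= mu A)%E -> (s%:E <= mu B)%E -> 1 < r + s -> A `&` B !=set0.
Proof.
move=> mA mB rA sB rs; apply/set0P/eqP => AB0.
have : (mu (A `|` B) <= 1)%E by apply: probability_le1; exact: measurableU.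
rewrite measureU//; apply/negP; rewrite -ltNge.
by apply: lt_le_trans (leeD rA sB); rewrite -EFinD lte_fin.
Qed.

Lemma measurable_preimage (f : continuousType X X) A :
  measurable A -> measurable (f @^-1` A : set (borel X)).
Proof.
move=> mA; rewrite -[_ @^-1` _]setTI.
exact: (measurable_funPT (borel_fun f)).
Qed.

Lemma orbit_map_induced (f : nat -> continuousType X X) n mu A : measurable A ->
  orbit_map (fun n => induced_map (f n)) n mu A =
  mu (orbit_map (fun n => f n : X -> X) n @^-1` A).
Proof.
elim: n A => [//|n IHn] A mA /=; rewrite induced_mapE// IHn//.
exact: measurable_preimage.
Qed.

Lemma prohorov_thickening mu nu (e r : R) A : mdist mu nu < e ->
  measurable A -> (r%:E <= mu A)%E -> ((r - e)%:E <= nu (thickening A e))%E.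
Proof.
move=> /prohorov_lt[_ /(_ A)] H /H[{}H _] rA.
by rewrite EFinB leeBlDr//; exact: le_trans H.
Qed.

Definition two_point_fun (a c : X) : bool -> borel X :=
  fun b => if b then a else c.

Let measurable_two_point_fun a c : measurable_fun setT (two_point_fun a c).
Proof. by []. Qed.

HB.instance Definition _ a c := isMeasurableFun.Build _ _ _ _
  (two_point_fun a c) (measurable_two_point_fun a c).

(** The measure [(delta_a + delta_c) / 2], as the law of a function of a fair coin; for [a = c] it
    is a Dirac measure. *)
Definition two_point (a c : X) : borel_prob X :=
  borel_prob_of (distribution (bernoulli_prob 2^-1) (two_point_fun a c)).

Lemma two_pointE a c A : measurable A ->
  two_point a c A = (2^-1 * (a \in A)%:R + 2^-1 * (c \in A)%:R)%:E.
Proof.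
move=> mA; rewrite borel_prob_ofE//= /distribution /pushforward.
rewrite bernoulli_probE ?invr_ge0//=; last by lra.
rewrite !diracE -!EFinM -EFinD; congr (_ * _ + _ * _)%:E.
by rewrite -[LHS]/(1 - 2^-1); lra.
Qed.

End borel_prob_facts.

(** * A weakly mixing sequence of affine maps *)

Section affine_system.
Local Open Scope ring_scope.
Context {R : realType}.

(** Transitivity on pairs of distinct points, restricted to rational points so that countably many
    maps can achieve it. *)
Definition rat_transitive2 (c : nat -> R * R) : Prop :=
  forall p1 p2 q1 q2 : rat, p1 != p2 -> q1 != q2 ->
    `|ratr p1 : R| < 1 -> `|ratr p2 : R| < 1 ->
    `|ratr q1 : R| < 1 -> `|ratr q2 : R| < 1 ->
    exists k, caff (c k).1 (c k).2 (ratr p1) = ratr q1 /\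
      caff (c k).1 (c k).2 (ratr p2) = ratr q2.

Lemma affine_enumeration : exists c : nat -> R * R,
  (forall k, (c k).1 != 0) /\ rat_transitive2 c.
Proof.
pose good (t : rat * rat * (rat * rat)) (ab : R * R) := ab.1 != 0 /\
  (t.1.1 != t.1.2 -> t.2.1 != t.2.2 ->
   `|ratr t.1.1 : R| < 1 -> `|ratr t.1.2 : R| < 1 ->
   `|ratr t.2.1 : R| < 1 -> `|ratr t.2.2 : R| < 1 ->
   caff ab.1 ab.2 (ratr t.1.1) = ratr t.2.1 /\
   caff ab.1 ab.2 (ratr t.1.2) = ratr t.2.2).
(* One map is chosen for each quadruple of rationals, with the identity [(1, 0)] as default when the
   quadruple is not admissible. *)
have [g gP] : {g & forall t, good t (g t)}.
  apply: choice => -[[p1 p2] [q1 q2]]; rewrite /good /=.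
  have [H|H] := pselect [/\ p1 != p2, q1 != q2, `|ratr p1 : R| < 1 &
    [/\ `|ratr p2 : R| < 1, `|ratr q1 : R| < 1 & `|ratr q2 : R| < 1]].
    move: H => [p12 q12 p11 [p21 q11 q21]].
    have [||a [b [a0 E1 E2]]] := caff_transitive2 p11 p21 q11 q21.
    - by rewrite (inj_eq (fmorph_inj _)).
    - by rewrite (inj_eq (fmorph_inj _)).
    by exists (a, b).
  by exists (1, 0); split=> [|*]; [exact: oner_neq0|exfalso; exact: H].
(* Quadruples of rationals are countable; integers that encode none receive the identity. *)
exists (fun k => if unpickle k is Some t then g t else (1, 0)); split.
  move=> k; case: unpickle => [t|]; last exact: oner_neq0.
  by have [] := gP t.
move=> p1 p2 q1 q2 *; exists (pickle ((p1, p2), (q1, q2))); rewrite pickleK.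
by have [_] := gP ((p1, p2), (q1, q2)); apply.
Qed.

(* Each map [c k] is followed by its inverse, so that the composition of the
   first [2k] maps is the identity and that of the first [2k + 1] is [c k]. *)
Definition affine_system (c : nat -> R * R) (n : nat) : seg R -> seg R :=
  let a := (c n./2).1 in let b := (c n./2).2 in
  if odd n then seg_caff a^-1 (- b / a) else seg_caff a b.

Variable c : nat -> R * R.
Hypothesis c0 : forall k, (c k).1 != 0.

Lemma continuous_affine_system n : continuous (affine_system c n).
Proof.
by rewrite /affine_system; case: ifP => _; apply: continuous_seg_caff;
  rewrite ?invr_eq0.
Qed.

Lemma orbit_affine_system_even k : orbit_map (affine_system c) k.*2 = id.
Proof.
elim: k => [//|k IHk]; rewrite doubleS /= IHk.
apply/funext => x /=; rewrite /affine_system /= odd_double /=.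
by rewrite uphalf_double doubleK seg_caffK.
Qed.

Lemma orbit_affine_system_odd k : orbit_map (affine_system c) k.*2.+1 =
  seg_caff (c k).1 (c k).2.
Proof.
by rewrite /= orbit_affine_system_even /affine_system odd_double doubleK.
Qed.

(** A composition is either the identity, which is [seg_caff 1 0], or a single map of the family,
    according to the parity of [n]. *)
Lemma orbit_affine_system n : exists a b, a != 0 /\
  orbit_map (affine_system c) n = seg_caff a b.
Proof.
rewrite -(odd_double_half n); case: (odd n); rewrite ?add1n ?add0n.
  by exists (c n./2).1, (c n./2).2; rewrite orbit_affine_system_odd.
exists 1, 0; rewrite oner_neq0 orbit_affine_system_even; split=> //.
by apply/funext => x; rewrite seg_caff10.
Qed.

Lemma weakly_mixing_affine_system :
  rat_transitive2 c -> weakly_mixing (affine_system c) 2.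
Proof.
move=> cP U V UP VP; pose i0 : 'I_2 := ord0; pose i1 : 'I_2 := lift ord0 ord0.
have pick (W : set (seg R)) (r : rat) : open W /\ W !=set0 -> exists q : rat,
  [/\ q != r, `|ratr q : R| < 1 & W (clamp (ratr q))].
  by case=> oW W0; exact: rat_in_open_seg.
(* The excluded value [0] is a dummy; the second point of each pair is chosen to avoid the first. *)
have [p1 [_ p11 Up1]] := pick _ 0 (UP i0).
have [p2 [p21 p21' Up2]] := pick _ p1 (UP i1).
have [q1 [_ q11 Vq1]] := pick _ 0 (VP i0).
have [q2 [q21 q21' Vq2]] := pick _ q1 (VP i1).
have [||k [E1 E2]] := cP p1 p2 q1 q2 _ _ p11 p21' q11 q21'.
- by rewrite eq_sym.
- by rewrite eq_sym.
(* At this time the composition is exactly the map number [k]. *)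
exists k.*2.+1 => i _; split=> //; rewrite orbit_affine_system_odd.
have [->|->] : i = i0 \/ i = i1.
  by case: i => [[|[|//]] ?]; [left|right]; exact: val_inj.
- exists (clamp (ratr q1)); split=> //; exists (clamp (ratr p1)) => //.
  by rewrite /seg_caff val_clamp ?ltW// E1.
- exists (clamp (ratr q2)); split=> //; exists (clamp (ratr p2)) => //.
  by rewrite /seg_caff val_clamp ?ltW// E2.
Qed.

End affine_system.

(** * Failure of weak mixing for the induced maps *)

Section induced_affine_system.
Local Open Scope ring_scope.
Context {R : realType}.

Lemma not_weakly_mixing_induced_affine
    (f : nat -> continuousType (seg R) (seg R)) :
  (forall n, exists a b, a != 0 /\
     orbit_map (fun n => f n : seg R -> seg R) n = seg_caff a b) ->
  ~ weakly_mixing (fun n => induced_map (f n)) 2.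
Proof.
move=> fP.
(* With this [e], the masses [1/2 - e] and [1 - e] add up to more than 1, and the balls of radius
   [2 e = 1/8] around 1/4, 1/2 and 3/4 lie in order inside [0, 1]. *)
pose e : R := 16^-1; have e0 : 0 < e by rewrite invr_gt0.
pose nb (mu : borel_prob (seg R)) := thickening [set mu] e.
pose B (x : R) : set (borel (seg R)) := thickening [set clamp x : seg R] e.
(* A measure at Prohorov distance less than [e] from one charging [B x] charges its thickening
   [B2 x], up to a loss of [e]. *)
pose B2 (x : R) : set (borel (seg R)) := thickening (B x) e.
have mB x : measurable (B x) by exact: measurable_thickening.
have mB2 x : measurable (B2 x) by exact: measurable_thickening.
have BB x : clamp x \in B x.
  by rewrite inE; apply: sub_thickening.
have B2P x y : `|x| <= 1 -> B2 x y -> `|val y - x| < 8^-1.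
  move=> x1 /thickening_thickening/thickeningP[_ ->].
  by rewrite seg_mdistE val_clamp// /e; lra.
pose tp (x y : R) := two_point (clamp x : seg R) (clamp y).
pose U (i : 'I_2) := nb (if i == ord0 then tp 4^-1 (3 / 4) else tp 2^-1 2^-1).
pose V (i : 'I_2) := nb (if i == ord0 then tp 0 0 else tp 1 1).
have nbO mu : open (nb mu) /\ nb mu !=set0.
  by split; [exact: open_thickening|exists mu; exact: sub_thickening].
move=> /(_ U V (fun _ => nbO _) (fun _ => nbO _))[n nP].
have [a [b [a0 fE]]] := fP n.
pose g := orbit_map (fun n => f n : seg R -> seg R) n.
have mg A : measurable (A : set (borel (seg R))) ->
    measurable (g @^-1` A : set (borel (seg R))).
  rewrite /g; elim: (n) A => [//|m IH] A mA /=.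
  exact: (IH _ (measurable_preimage (f m) mA)).
have gE x : val (g x) = caff a b (val x) by rewrite /g fE val_seg_caff.
have near x y z mu : x = z \/ y = z -> mdist mu (tp x y) < e ->
    ((2^-1 - e)%:E <= mu (B2 z))%E.
  move=> xyz d; apply: (prohorov_thickening (mu := tp x y)) => //.
    by rewrite metric_sym.
  rewrite two_pointE// lee_fin; case: xyz => <-; rewrite BB mulr1.
    by rewrite lerDl.
  by rewrite lerDr.
have near1 x mu : mdist mu (tp x x) < e -> ((1 - e)%:E <= mu (B2 x))%E.
  move=> d; apply: (prohorov_thickening (mu := tp x x)) => //.
    by rewrite metric_sym.
  by rewrite two_pointE// lee_fin BB mulr1; lra.
have [_ [_ [[mu1 U1 <-] V1]]] := nP ord0 I.
have [_ [_ [[mu2 U2 <-] V2]]] := nP (lift ord0 ord0) I.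
move: U1 V1 U2 V2 => /thickeningP[_ -> U1] /thickeningP[_ -> V1].
move=> /thickeningP[_ -> U2] /thickeningP[_ -> V2].
move: V1 V2 => /near1 + /near1; rewrite !orbit_map_induced// => V1 V2.
(* [mu1] gives mass at least [1/2 - e] to points near [z], and at least [1 - e] to points that [g]
   sends near 0, so some point does both. *)
have hit z : 4^-1 = z \/ 3 / 4 = z -> `|z| <= 1 ->
    exists x, `|val x - z| < 8^-1 /\ `|val (g x)| < 2^-1.
  move=> zP z1.
  have [|||x [xz gx]] := probability_meet _ _ (near _ _ z _ zP U1) V1.
  - exact: mB2.
  - exact: (mg _ (mB2 _)).
  - by rewrite /e; lra.
  exists x; split; first exact: B2P.
  by have := B2P _ _ _ gx; rewrite normr0 subr0 => /(_ ler01); lra.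
have [||x1 [x1P g1]] := hit 4^-1; [by left|by rewrite ger0_norm; lra|].
have [||x3 [x3P g3]] := hit (3 / 4); [by right|by rewrite ger0_norm; lra|].
(* Likewise [mu2] yields a point near 1/2 that [g] sends near 1. *)
have [|||x2 [x2P g2]] := probability_meet _ _ (near1 _ _ U2) V2.
- exact: mB2.
- exact: (mg _ (mB2 _)).
- by rewrite /e; lra.
move: x2P g2 => /B2P x2P /B2P g2.
have {}x2P : `|val x2 - 2^-1| < 8^-1 by apply: x2P; rewrite ger0_norm; lra.
have {}g2 : `|val (g x2) - 1| < 8^-1 by apply: g2; rewrite normr1.
(* [x2] lies between [x1] and [x3], so betweenness forces its image within 1/2 of 0, against its
   being near 1. *)
suff : `|val (g x2)| < 2^-1 by move: g2; rewrite !ltr_norml; lra.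
move: g1 g3; rewrite !gE => g1 g3.
rewrite !ltr_norml in x1P x2P x3P.
by apply: (caff_between a0 _ _ _ _ g1 g3); lra.
Qed.

End induced_affine_system.

Theorem theorem2p7 (R : realType) :
  exists (X : pmetricType R) (f : nat -> continuousType X X),
    [/\ compact [set: X],
        weakly_mixing (fun n => f n : X -> X) 2 &
        ~ weakly_mixing (fun n => induced_map (f n)) 2].
Proof.
have [c [c0 cP]] := @affine_enumeration R.
pose F n := isContinuous.Build _ _ (affine_system c n)
  (@continuous_affine_system _ _ c0 n).
pose f n : continuousType (seg R) (seg R) :=
  HB.pack (affine_system c n) (F n).
exists (seg R), f; split.
- exact: compact_seg.
- exact: weakly_mixing_affine_system.
- by apply: not_weakly_mixing_induced_affine => n; exact: orbit_affine_system.
Qed.
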